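(* Let $x>2$ be a half-odd integer (i.e. $x=m+\tfrac12$ for an integer $m$), let $k=1+1/\log x$, and let $T>0$. Define $R_2(x,T)$ by $$\pi(x)=\frac{1}{2\pi i}\int_{k-iT}^{k+iT}\frac{x^s}{s}\log\zeta(s)\,\mathrm ds+R_2(x,T).$$ Then $$R_2(x,T)\ll\frac{x\log x}{T}+\sqrt{x}\,\log\log x,$$ with an absolute implied constant.
   Context: $\pi(x)$ is the number of primes $p\le x$. $\zeta$ is the Riemann zeta function, and for $\Re(s)>1$, $\log\zeta(s)$ denotes the branch given by the absolutely convergent series $\sum_{n\ge1}a_n n^{-s}$, where $a_n=1/k$ if $n=p^k$ with $p$ prime, $k\ge1$, and $a_n=0$ otherwise. The integral is along the vertical segment from $k-iT$ to $k+iT$.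
   Formalization: The term log log x in the bound is replaced by its absolute value |log log x|, because at x = 5/2 it is negative and the stated bound becomes negative for large T; for all other admissible x nothing changes. *)

(* Defs.v *)
(* Stdlib reals with Coquelicot; primes come from MathComp's [prime.v]. *)
From Stdlib Require Import Reals Lra Lia.
From Coquelicot Require Import Coquelicot.
From mathcomp Require Import all_boot.

Set Implicit Arguments.
Unset Strict Implicit.
Unset Printing Implicit Defensive.

Open Scope R_scope.

(* [up x] is the integer with [x < up x <= x + 1], so the naturals below it
   are exactly those [<= x]; see [mem_prime_pi_range]. *)
Definition prime_pi (x : R) : nat := count prime (iota 0%N (Z.to_nat (up x))).

Definition Cexp (z : C) : C := (exp (Re z) * cos (Im z), exp (Re z) * sin (Im z)).

(* Intended for [0 < x]. *)
Definition Rcpow (x : R) (s : C) : C := Cexp (s * RtoC (ln x))%C.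

(* [primes n] lists the distinct prime divisors of [n], so it is a singleton
   [p] iff [n = p ^ k] with [k >= 1], and then [k = logn p n]. *)
Definition log_zeta_coef (n : nat) : R :=
  if primes n is [:: p] then / INR (logn p n) else 0.

Definition log_zeta_term (s : C) (n : nat) : C :=
  (RtoC (log_zeta_coef n) * Rcpow (INR n) (- s))%C.

(* The branch of [log zeta] given, for [1 < Re s], by its absolutely
   convergent Dirichlet series; the value is junk for other [s]. *)
Definition log_zeta (s : C) : C :=
  (Series (fun n => Re (log_zeta_term s n.+1)),
   Series (fun n => Im (log_zeta_term s n.+1))).

(* Parametrised by [s = c + i t], whence [ds = i dt]. *)
Definition vertical_integral (f : C -> C) (c T : R) : C :=
  (Ci * RInt (V := C_R_CompleteNormedModule) (fun t : R => f (c, t)) (- T) T)%C.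

Definition R2 (x T : R) : C :=
  let k := 1 + 1 / ln x in
  (RtoC (INR (prime_pi x))
   - / (RtoC (2 * PI) * Ci)
     * vertical_integral (fun s => Rcpow x s / s * log_zeta s) k T)%C.

Definition half_odd (x : R) : Prop := exists m : Z, x = IZR m + 1 / 2.

Lemma mem_prime_pi_range (x : R) (n : nat) :
  n \in iota 0%N (Z.to_nat (up x)) <-> INR n <= x.
Proof.
have [h1 h2] := archimed x.
rewrite mem_iota /= add0n INR_IZR_INZ; split => h.
- have {}h : (Z.of_nat n + 1 <= up x)%Z by move/ltP: h; lia.
  move/IZR_le: h; rewrite plus_IZR; lra.
- have /lt_IZR {}h : IZR (Z.of_nat n) < IZR (up x) by lra.
  apply/ltP; lia.
Qed.

Lemma log_zeta_coef_prime_power (p k : nat) :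
  prime p -> (0 < k)%N -> log_zeta_coef (p ^ k)%N = / INR k.
Proof.
move=> pp k0.
by rewrite /log_zeta_coef primesX // primes_prime // pfactorK.
Qed.

Lemma log_zeta_coef_eq0 (n : nat) :
  (forall p k : nat, prime p -> (0 < k)%N -> n <> (p ^ k)%N) ->
  log_zeta_coef n = 0.
Proof.
move=> h; rewrite /log_zeta_coef.
case: (posnP n) => [-> // | n0].
case E : (primes n) => [|p [|q s]] //.
have : p \in primes n by rewrite E mem_head.
rewrite mem_primes => /and3P[pp _ pn]; case: (h p (logn p n) pp).
  by rewrite logn_gt0 E mem_head.
by rewrite {1}(prod_prime_decomp n0) prime_decompE E /= big_seq1.
Qed.

(* Main.v *)
Require Import Defs.
From Stdlib Require Import Reals Lra Lia.
From Coquelicot Require Import Coquelicot.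
From mathcomp Require Import all_boot.

(* The truncated integral [G L] of [e^(L s) / s] is evaluated without contour
   integration: [G' L = e^(k L) (2 sin (T L) / L)] gives
   [G L = 2 atan (T / k) + D k], where [D a] is the integral of
   [e^(a u) (2 sin (T u) / u)] for [u] from [0] to [L], and
   [D' a - 2 T / (a^2 + T^2)] is elementary and at most [2 e^(a L) / T] in
   absolute value. Letting [a] tend to [-oo] when [0 < L] and to [+oo] when
   [L < 0] yields [G L = 2 pi [0 < L] + O(e^(k L) / (T |L|))].
   Summed over the Dirichlet series with [L = ln (x / n)], the errors amount to
   [O(x ln x / T)] because [|ln (x / n)| >= |x - n| / max(x, n)] and
   [|x - n| >= 1/2]. What is left, [sum_(n < x) a_n - pi(x)], counts the proper
   powers [q^k <= x] with weight [1/k]; there are at most [sqrt x] bases and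
   [k <= log_2 x], hence the bound [sqrt x ln ln x]. *)

Open Scope R_scope.

(** * The truncated Perron integral *)

Lemma RInt_Rmult_l (c : R) (f : R -> R) (a b : R) :
  ex_RInt f a b -> RInt (fun t => c * f t) a b = c * RInt f a b.
Proof. exact: (RInt_scal (V := R_CompleteNormedModule)). Qed.

Lemma ex_derive_continuity_pt (f : R -> R) (x : R) : ex_derive f x -> continuity_pt f x.
Proof. by move=> h; apply: derivable_continuous_pt; apply: ex_derive_Reals_0. Qed.

(** Differentiation under the integral sign with a named derivative [df] and global hypotheses, so
    that each use only has to check elementary formulas. *)
Lemma is_derive_RInt_param_everywhere (f df : R -> R -> R) (a b x : R) :
  (forall y t, is_derive (fun u => f u t) y (df y t)) ->
  (forall y t, continuity_2d_pt df y t) ->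
  (forall y t, continuous (f y) t) ->
  is_derive (fun y => RInt (f y) a b) x (RInt (df x) a b).
Proof.
move=> Hd Hc Hf.
have E y t : Derive (fun u => f u t) y = df y t by apply: is_derive_unique.
rewrite -(RInt_ext (fun t => Derive (fun u => f u t) x)); last by move=> t _; exact: E.
apply: is_derive_RInt_param.
- by apply: filter_forall => y t _; exists (df y t).
- move=> t _; apply: continuity_2d_pt_ext (Hc x t) => u v; by rewrite E.
- by apply: filter_forall => y; apply: ex_RInt_continuous => t _; apply: Hf.
Qed.

(* [perron_re] and [perron_im] are the components of [e^(s L) / s] at [s = k + i t]. *)
Definition perron_re (k L t : R) : R :=
  exp (k * L) * (k * cos (t * L) + t * sin (t * L)) / (k * k + t * t).

Definition perron_im (k L t : R) : R :=
  exp (k * L) * (k * sin (t * L) - t * cos (t * L)) / (k * k + t * t).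

(** This is [2 sin (T L) / L] for [L <> 0]; the integral form makes it continuous at [L = 0] as
    well. *)
Definition cos_integral (T L : R) : R := RInt (fun t => cos (t * L)) (- T) T.

Lemma sum_sqr_pos (k t : R) : k <> 0 -> 0 < k * k + t * t.
Proof. move=> k0; have := Rle_0_sqr t; have := Rsqr_pos_lt k k0; rewrite /Rsqr; lra. Qed.

Lemma continuous_perron_re (k L t : R) : k <> 0 -> continuous (perron_re k L) t.
Proof.
move=> k0; apply: ex_derive_continuous; rewrite /perron_re; auto_derive.
have := sum_sqr_pos k t k0; lra.
Qed.

Lemma continuous_perron_im (k L t : R) : k <> 0 -> continuous (perron_im k L) t.
Proof.
move=> k0; apply: ex_derive_continuous; rewrite /perron_im; auto_derive.
have := sum_sqr_pos k t k0; lra.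
Qed.

Lemma continuity_2d_pt_exp_cos (k L t : R) :
  continuity_2d_pt (fun L t => exp (k * L) * cos (t * L)) L t.
Proof.
apply: continuity_2d_pt_mult.
- apply: (continuity_1d_2d_pt_comp (fun z => exp (k * z)) (fun u _ => u)).
    by apply: ex_derive_continuity_pt; auto_derive.
  exact: continuity_2d_pt_id1.
- apply: (continuity_1d_2d_pt_comp cos (fun u v => v * u)).
    exact: continuity_cos.
  apply: continuity_2d_pt_mult; [exact: continuity_2d_pt_id2|exact: continuity_2d_pt_id1].
Qed.

(** Since [d/dL (e^(s L) / s) = e^(s L)], differentiation removes the denominator and leaves the
    real part [e^(k L) cos (t L)] under the integral. *)
Lemma is_derive_RInt_perron_re (k T L : R) : k <> 0 ->
  is_derive (fun L => RInt (perron_re k L) (- T) T) L (exp (k * L) * cos_integral T L).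
Proof.
move=> k0.
rewrite /cos_integral -RInt_Rmult_l; last first.
  apply: ex_RInt_continuous => t _; apply: ex_derive_continuous; by auto_derive.
apply: (is_derive_RInt_param_everywhere _ (fun L t => exp (k * L) * cos (t * L))).
- move=> y t; rewrite /perron_re; have h := sum_sqr_pos k t k0; auto_derive; first lra.
  field; lra.
- by move=> y t; apply: continuity_2d_pt_exp_cos.
- by move=> y t; apply: continuous_perron_re.
Qed.

Lemma continuous_cos_integral (T L : R) : continuous (cos_integral T) L.
Proof.
apply: ex_derive_continuous; rewrite /cos_integral.
exists (RInt (fun t => - (t * sin (t * L))) (- T) T).
apply: (is_derive_RInt_param_everywhere (fun L t => cos (t * L))
  (fun L t => - (t * sin (t * L)))).
- by move=> y t; auto_derive => //; ring.
- move=> y t; apply: continuity_2d_pt_opp; apply: continuity_2d_pt_mult.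
    exact: continuity_2d_pt_id2.
  apply: (continuity_1d_2d_pt_comp sin (fun u v => v * u)).
    exact: continuity_sin.
  apply: continuity_2d_pt_mult; [exact: continuity_2d_pt_id2|exact: continuity_2d_pt_id1].
- by move=> y t; apply: ex_derive_continuous; auto_derive.
Qed.

Lemma cos_integral_mul (T L : R) : L * cos_integral T L = 2 * sin (T * L).
Proof.
rewrite /cos_integral -RInt_Rmult_l; last first.
  apply: ex_RInt_continuous => t _; apply: ex_derive_continuous; by auto_derive.
have -> : 2 * sin (T * L) = sin (T * L) - sin (- T * L).
  by rewrite Ropp_mult_distr_l_reverse sin_neg; ring.
apply: is_RInt_unique; apply: (is_RInt_derive (fun t => sin (t * L))) => t _.
  by auto_derive => //; rewrite /scal /= /mult /=; ring.
by apply: ex_derive_continuous; auto_derive.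
Qed.

Lemma cos_integral_bound (T L : R) : 0 <= T -> Rabs (cos_integral T L) <= 2 * T.
Proof.
move=> T0; have -> : 2 * T = (T - - T) * 1 by ring.
apply: abs_RInt_le_const; first lra.
  apply: ex_RInt_continuous => t _; apply: ex_derive_continuous; by auto_derive.
move=> t _; apply: Rabs_le; have := COS_bound (t * L); lra.
Qed.

Definition damped (T L a : R) : R := RInt (fun u => exp (a * u) * cos_integral T u) 0 L.

Lemma continuous_damped_integrand (T a u : R) :
  continuous (fun u => exp (a * u) * cos_integral T u) u.
Proof.
apply: (continuous_mult (fun u => exp (a * u))); last exact: continuous_cos_integral.
by apply: ex_derive_continuous; auto_derive.
Qed.

(** Differentiating in [a] brings down a factor [u], which turns [cos_integral T u] into
    [2 sin (T u)]; the integrand then has the elementary primitive [F], and [2 T / (a^2 + T^2)] is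
    [- F 0]. *)
Lemma is_derive_damped (T L a : R) : 0 < T ->
  is_derive (damped T L) a
    (2 * exp (a * L) * (a * sin (T * L) - T * cos (T * L)) / (a * a + T * T)
     + 2 * T / (a * a + T * T)).
Proof.
move=> T0; have p y : 0 < y * y + T * T by rewrite Rplus_comm; apply: sum_sqr_pos; lra.
set l := (X in is_derive _ _ X).
have -> : l = RInt (fun u => exp (a * u) * (2 * sin (T * u))) 0 L.
  pose F u := 2 * exp (a * u) * (a * sin (T * u) - T * cos (T * u)) / (a * a + T * T).
  have -> : l = F L - F 0.
    rewrite /l /F !Rmult_0_r exp_0 sin_0 cos_0; field; have := p a; lra.
  symmetry; apply: is_RInt_unique; apply: (is_RInt_derive F) => u _.
    by rewrite /F; auto_derive => //; field; have := p a; lra.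
  by apply: ex_derive_continuous; auto_derive.
apply: (is_derive_RInt_param_everywhere (fun a u => exp (a * u) * cos_integral T u)
  (fun a u => exp (a * u) * (2 * sin (T * u)))).
- move=> y u; rewrite -cos_integral_mul; auto_derive => //; ring.
- move=> y u; apply: continuity_2d_pt_mult.
    apply: (continuity_1d_2d_pt_comp exp (fun u v => u * v)).
      by apply: derivable_continuous; apply: derivable_exp.
    apply: continuity_2d_pt_mult; [exact: continuity_2d_pt_id1|exact: continuity_2d_pt_id2].
  apply: (continuity_1d_2d_pt_comp (fun z => 2 * sin (T * z)) (fun _ v => v)).
    by apply: ex_derive_continuity_pt; auto_derive.
  exact: continuity_2d_pt_id2.
- by move=> y u; apply: continuous_damped_integrand.
Qed.

(** Both sides have the same derivative in [L] and agree at [L = 0], where the integrand is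
    [k / (k^2 + t^2)]. *)
Lemma RInt_perron_re_eq (k T L : R) : 0 < k -> 0 < T ->
  RInt (perron_re k L) (- T) T = 2 * atan (T / k) + damped T L k.
Proof.
move=> k0 T0; have nk : k <> 0 by lra.
have E0 : RInt (perron_re k 0) (- T) T = 2 * atan (T / k).
  have -> : 2 * atan (T / k) = atan (T / k) - atan (- T / k).
    have -> : - T / k = - (T / k) by field.
    rewrite atan_opp; ring.
  apply: is_RInt_unique; apply: (is_RInt_derive (fun t => atan (t / k))) => t _.
    rewrite /perron_re !Rmult_0_r exp_0 sin_0 cos_0.
    have h := sum_sqr_pos k t nk.
    auto_derive => //; rewrite /Rsqr; field; split; lra.
  exact: continuous_perron_re.
have H : is_RInt (fun u => exp (k * u) * cos_integral T u) 0 L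
  (minus (RInt (perron_re k L) (- T) T) (RInt (perron_re k 0) (- T) T)).
  apply: (is_RInt_derive (fun L => RInt (perron_re k L) (- T) T)) => u _.
    exact: is_derive_RInt_perron_re.
  exact: continuous_damped_integrand.
rewrite /damped (is_RInt_unique _ _ _ _ H) E0 /minus /plus /opp /=.
by apply: Rminus_diag_uniq; ring.
Qed.

Lemma atan_le_id (y : R) : 0 <= y -> atan y <= y.
Proof.
move=> y0; have [c [_ e]] := MVT_gen atan 0 y (fun x => / (1 + x²))
  (fun x _ => is_derive_atan x)
  (fun x _ => ex_derive_continuity_pt _ _ (ex_intro _ _ (is_derive_atan x))).
rewrite atan_0 in e.
have h : / (1 + c²) <= 1.
  rewrite -Rinv_1; apply: Rinv_le_contravar; have := Rle_0_sqr c; lra.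
have := Rmult_le_compat_r y _ _ y0 h; lra.
Qed.

Lemma PI2_sub_atan_bound (A T : R) : 0 < A -> 0 < T -> 0 <= PI / 2 - atan (A / T) <= T / A.
Proof.
move=> A0 T0; have q : 0 < T / A by apply: Rdiv_lt_0_compat.
have -> : A / T = / (T / A) by field; lra.
rewrite atan_inv //; have := atan_le_id (T / A) (Rlt_le _ _ q).
have := atan_increasing _ _ q; rewrite atan_0; lra.
Qed.

Lemma atan_div_swap (A T : R) : 0 < A -> 0 < T -> atan (A / T) = PI / 2 - atan (T / A).
Proof.
move=> A0 T0; have -> : A / T = / (T / A) by field; lra.
by rewrite atan_inv //; apply: Rdiv_lt_0_compat.
Qed.

Lemma Rabs_RInt_le (f g : R -> R) (a b : R) : a <= b ->
  (forall x, continuous f x) -> (forall x, continuous g x) ->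
  (forall x, a <= x <= b -> Rabs (f x) <= g x) ->
  Rabs (RInt f a b) <= RInt g a b.
Proof.
move=> ab cf cg h.
have ef : ex_RInt f a b by apply: ex_RInt_continuous => x _; apply: cf.
apply: Rle_trans (abs_RInt_le _ _ _ ab ef) _.
apply: RInt_le => //.
- apply: ex_RInt_continuous => x _; apply: continuous_comp (cf x) _.
  exact: continuous_Rabs.
- by apply: ex_RInt_continuous => x _; apply: cg.
- by move=> x hx; apply: h; lra.
Qed.

Lemma RInt_exp (B a u v : R) : a <> 0 ->
  RInt (fun t => B * exp (a * t)) u v = B / a * (exp (a * v) - exp (a * u)).
Proof.
move=> a0; have -> : B / a * (exp (a * v) - exp (a * u)) =
  B / a * exp (a * v) - B / a * exp (a * u) by ring.
apply: is_RInt_unique; apply: (is_RInt_derive (fun t => B / a * exp (a * t))) => t _.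
  by auto_derive => //; field.
by apply: ex_derive_continuous; auto_derive.
Qed.

(** For [L <> 0] the hypothesis makes [a] equal to [A] with the sign opposite to that of [L], so
    [e^(a u)] decays from [u = 0] towards [L] and its integral is at most [1 / A]. *)
Lemma damped_bound (T L A a : R) : 0 < T -> 0 < A -> a * L = - A * Rabs L ->
  Rabs (damped T L a) <= 2 * T / A.
Proof.
move=> T0 A0 aL; rewrite /damped.
have cf := continuous_damped_integrand T a.
have cg (x : R) : continuous (fun u => 2 * T * exp (a * u)) x.
  by apply: ex_derive_continuous; auto_derive.
have hb x : Rabs (exp (a * x) * cos_integral T x) <= 2 * T * exp (a * x).
  rewrite Rabs_mult (Rabs_pos_eq (exp _)); last by left; apply: exp_pos.
  rewrite Rmult_comm; apply: Rmult_le_compat_r; first by left; apply: exp_pos.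
  apply: cos_integral_bound; lra.
have q : 0 < 2 * T / A by apply: Rdiv_lt_0_compat; lra.
case: (Rtotal_order L 0) => [L0|[->|L0]].
- have ea : a = A by move: aL; rewrite Rabs_left // => aL; apply: (Rmult_eq_reg_r L); lra.
  rewrite -opp_RInt_swap; last by apply: ex_RInt_continuous => x _; apply: cf.
  rewrite /opp /= Rabs_Ropp.
  apply: Rle_trans (Rabs_RInt_le _ _ L 0 (Rlt_le _ _ L0) cf cg (fun x _ => hb x)) _.
  rewrite RInt_exp; last lra.
  rewrite ea Rmult_0_r exp_0.
  have := Rmult_lt_0_compat _ _ q (exp_pos (A * L)); lra.
- by rewrite RInt_point /zero /= Rabs_R0; lra.
- have ea : a = - A.
    by move: aL; rewrite Rabs_pos_eq; [move=> aL; apply: (Rmult_eq_reg_r L); lra|lra].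
  apply: Rle_trans (Rabs_RInt_le _ _ 0 L (Rlt_le _ _ L0) cf cg (fun x _ => hb x)) _.
  rewrite RInt_exp; last lra.
  rewrite ea Rmult_0_r exp_0.
  have -> : 2 * T / - A * (exp (- A * L) - 1) = 2 * T / A * (1 - exp (- A * L)) by field; lra.
  have := Rmult_lt_0_compat _ _ q (exp_pos (- A * L)); lra.
Qed.

Lemma Rabs_incr_le_of_derive (f g df dg : R -> R) (a b : R) : a <= b ->
  (forall x, is_derive f x (df x)) -> (forall x, is_derive g x (dg x)) ->
  (forall x, Rabs (df x) <= dg x) -> Rabs (f b - f a) <= g b - g a.
Proof.
move=> ab hf hg h; apply: Rabs_le.
(* The mean value theorem for [g + e f], whose derivative is nonnegative; [e = 1] and [e = -1] give
   the two inequalities. *)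
have mono (e : R) : Rabs e <= 1 -> 0 <= g b - g a + e * (f b - f a).
  move=> e1.
  have D x : is_derive (fun x => g x + e * f x) x (dg x + e * df x).
    by apply: is_derive_plus (hg x) _; apply: is_derive_scal (hf x).
  have [c [_ E]] := MVT_gen (fun x => g x + e * f x) a b (fun x => dg x + e * df x)
    (fun x _ => D x) (fun x _ => ex_derive_continuity_pt _ _ (ex_intro _ _ (D x))).
  have -> : g b - g a + e * (f b - f a) = g b + e * f b - (g a + e * f a) by ring.
  rewrite E; apply: Rmult_le_pos; last lra.
  have := h c; have := Rabs_pos (df c).
  have : - (e * df c) <= 1 * Rabs (df c).
    apply: Rle_trans (Rle_abs _) _; rewrite Rabs_Ropp Rabs_mult.
    by apply: Rmult_le_compat_r => //; apply: Rabs_pos.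
  lra.
split.
- have := mono 1; rewrite Rabs_R1; lra.
- have := mono (-1); rewrite Rabs_Ropp Rabs_R1; lra.
Qed.

Lemma Rabs_unit_comb_le (a T s c : R) : 0 < T -> s * s + c * c = 1 ->
  Rabs ((a * s - T * c) / (a * a + T * T)) <= / T.
Proof.
move=> T0 sc; have p : 0 < a * a + T * T by rewrite Rplus_comm; apply: sum_sqr_pos; lra.
set w := a * s - T * c.
have w2 : w * w <= a * a + T * T.
  have : (a * a + T * T) * (s * s + c * c) - w * w = Rsqr (a * c + T * s)
    by rewrite /w /Rsqr; ring.
  have := Rle_0_sqr (a * c + T * s); rewrite sc; lra.
rewrite /Rdiv Rabs_mult (Rabs_pos_eq (/ _)); last by left; apply: Rinv_0_lt_compat.
apply: (Rmult_le_reg_r (T * (a * a + T * T))); first exact: Rmult_lt_0_compat.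
have -> : Rabs w * / (a * a + T * T) * (T * (a * a + T * T)) = Rabs w * T by field; lra.
have -> : / T * (T * (a * a + T * T)) = a * a + T * T by field; lra.
(* AM-GM: [|w| T <= (w^2 + T^2) / 2] *)
have : Rabs w * Rabs w = w * w by rewrite -Rabs_mult Rabs_pos_eq //; apply: Rle_0_sqr.
have := Rle_0_sqr (Rabs w - T); rewrite /Rsqr; have := Rle_0_sqr a; rewrite /Rsqr; lra.
Qed.

(** Subtracting [2 atan (a / T)] removes [2 T / (a^2 + T^2)] from the derivative of [damped]; the
    oscillating rest is at most [2 e^(a L) / T], which has the primitive [2 e^(a L) / (T L)]. *)
Lemma damped_sub_atan_increment (T L a b : R) : 0 < T -> L <> 0 -> a <= b ->
  Rabs (damped T L b - 2 * atan (b / T) - (damped T L a - 2 * atan (a / T)))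
  <= 2 / (T * L) * exp (b * L) - 2 / (T * L) * exp (a * L).
Proof.
move=> T0 L0 ab.
apply: (Rabs_incr_le_of_derive (fun a => damped T L a - 2 * atan (a / T))
  (fun a => 2 / (T * L) * exp (a * L))
  (fun a => 2 * exp (a * L) * ((a * sin (T * L) - T * cos (T * L)) / (a * a + T * T)))
  (fun a => 2 * exp (a * L) * / T)) => // x.
- have p : 0 < x * x + T * T by rewrite Rplus_comm; apply: sum_sqr_pos; lra.
  have H : is_derive (fun a => 2 * atan (a / T)) x (2 * T / (x * x + T * T)).
    auto_derive => //; rewrite /Rsqr; field; lra.
  have D := is_derive_minus _ _ _ _ _ (is_derive_damped T L x T0) H.
  set l := (X in is_derive _ _ X); suff -> : l = minus
    (2 * exp (x * L) * (x * sin (T * L) - T * cos (T * L)) / (x * x + T * T)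
     + 2 * T / (x * x + T * T)) (2 * T / (x * x + T * T)) by [].
  rewrite /l /minus /plus /opp /=; field; lra.
- auto_derive => //; field; lra.
- rewrite Rabs_mult Rabs_pos_eq; last by have := exp_pos (x * L); lra.
  apply: Rmult_le_compat_l; first by have := exp_pos (x * L); lra.
  apply: Rabs_unit_comb_le => //; exact: sin2_cos2.
Qed.

Lemma Rle_of_forall_add_div (a b c : R) : 0 < c ->
  (forall A, 0 < A -> a <= b + c / A) -> a <= b.
Proof.
move=> c0 h; apply: le_epsilon => e e0.
have := h (c / e) (Rdiv_lt_0_compat _ _ c0 e0).
by have -> : c / (c / e) = e by field; lra.
Qed.

Lemma perron_bound (k T L : R) : 0 < k -> 0 < T -> L <> 0 ->
  Rabs (RInt (perron_re k L) (- T) T - (if Rlt_dec 0 L then 2 * PI else 0))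
  <= 2 * exp (k * L) / (T * Rabs L).
Proof.
move=> k0 T0 L0; rewrite RInt_perron_re_eq //.
have swap := atan_div_swap k T k0 T0.
(* The slack [4 T / A] pays for the far endpoint: [2 T / A] for [damped] and twice [T / A] for the
   arctangent. *)
apply: (Rle_of_forall_add_div _ _ (4 * T)) => [|A A0]; first lra.
have at_ := PI2_sub_atan_bound A T A0 T0.
have q : 4 * T / A = 2 * (T / A) + 2 * T / A by field; lra.
case: Rlt_dec => L1 /=.
(* For [0 < L] the comparison runs back to [- A], where [- 2 atan] is close to [PI]; with the [PI]
   coming from [swap] this makes [2 PI]. *)
- have I := damped_sub_atan_increment T L (- A) k T0 L0 ltac:(lra).
  have B : Rabs (damped T L (- A)) <= 2 * T / A.
    by apply: damped_bound => //; rewrite Rabs_pos_eq //; lra.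
  have c : 0 < 2 / (T * L) by apply: Rdiv_lt_0_compat; [lra|exact: Rmult_lt_0_compat].
  have := Rmult_lt_0_compat _ _ c (exp_pos (- A * L)).
  have e : 2 * exp (k * L) / (T * Rabs L) = 2 / (T * L) * exp (k * L).
    by rewrite Rabs_pos_eq; [field; lra|lra].
  have nA : atan (- A / T) = - atan (A / T).
    by rewrite -atan_opp; congr atan; field; lra.
  move/Rabs_le_between: I => I; move/Rabs_le_between: B => B H.
  rewrite nA in I; rewrite e; apply: Rabs_le; split; lra.
- have L2 : L < 0 by lra.
  have eL : Rabs L = - L by apply: Rabs_left.
  have c : 0 < 2 / (T * - L) by apply: Rdiv_lt_0_compat; [lra|apply: Rmult_lt_0_compat; lra].
  have B C : k <= C -> A <= C -> Rabs (damped T L C) <= 2 * T / A /\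
     0 <= PI / 2 - atan (C / T) <= T / A.
    move=> kC AC; have rA : T / C <= T / A.
      by apply: Rmult_le_compat_l; [lra|apply: Rinv_le_contravar].
    split.
      have : Rabs (damped T L C) <= 2 * T / C.
        by apply: damped_bound => //; [lra|rewrite eL; ring].
      have -> : 2 * T / C = 2 * (T / C) by field; lra.
      have -> : 2 * T / A = 2 * (T / A) by field; lra.
      lra.
    have := PI2_sub_atan_bound C T ltac:(lra) T0; lra.
  (* For [L < 0] the comparison runs forward to a point beyond both [k] and [A], where [- 2 atan] is
     close to [- PI] and cancels the [PI] from [swap]. *)
  have [B1 B2] := B (Rmax k A) (Rmax_l _ _) (Rmax_r _ _).
  have I := damped_sub_atan_increment T L k (Rmax k A) T0 L0 (Rmax_l _ _).
  have := Rmult_lt_0_compat _ _ c (exp_pos (Rmax k A * L)).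
  have e : 2 * exp (k * L) / (T * Rabs L) = - (2 / (T * L) * exp (k * L)).
    by rewrite eL; field; lra.
  have -> : 2 / (T * - L) = - (2 / (T * L)) by field; lra.
  move/Rabs_le_between: I => I; move/Rabs_le_between: B1 => B1 H.
  rewrite e; apply: Rabs_le; split; lra.
Qed.

(** * Sums over n of the Perron errors *)

(** The inequality [e^u >= 1 + u] at [u = ln (b / a)]. *)
Lemma ln_sub_ge (a b : R) : 0 < a -> 0 < b -> (a - b) / a <= ln a - ln b.
Proof.
move=> a0 b0; have q : 0 < b / a by apply: Rdiv_lt_0_compat.
have := exp_ineq1_le (ln (b / a)); rewrite exp_ln // ln_div //.
have -> : (a - b) / a = 1 - b / a by field; lra.
lra.
Qed.

Lemma inv_le_ln_sub (y : R) : 1 < y -> / y <= ln y - ln (y - 1).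
Proof.
move=> y1; have -> : / y = (y - (y - 1)) / y by field; lra.
by apply: ln_sub_ge; lra.
Qed.

Lemma ln_half_le (y : R) : 2 < y -> / 2 < ln y.
Proof.
move=> y2; apply: Rlt_trans ln_lt_2 _; apply: ln_increasing; lra.
Qed.

(** Discrete comparison with an integral: the sums below are bounded by exhibiting a primitive
    [g]. *)
Lemma sum_n_le_telescope (f g : nat -> R) :
  (forall i, f i.+1 <= g i.+1 - g i) -> forall N, sum_n f N <= f 0%N + g N - g 0%N.
Proof.
move=> h; elim=> [|N IH]; first by rewrite sum_O; lra.
rewrite sum_Sn /plus /=; have := h N; lra.
Qed.

Lemma sum_n_Rle (f g : nat -> R) (N : nat) :
  (forall i, (i <= N)%N -> f i <= g i) -> sum_n f N <= sum_n g N.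
Proof.
elim: N => [|N IH] h; first by rewrite !sum_O; apply: h.
rewrite !sum_Sn /plus /=; apply: Rplus_le_compat; last exact: h.
by apply: IH => i iN; apply: h; apply: leq_trans iN _.
Qed.

Lemma INR_ge1 (i : nat) : 1 <= INR i.+1.
Proof. rewrite S_INR; have := pos_INR i; lra. Qed.

(** The modulus of [n^(-s)] on the line [Re s = k], for [n >= 1]. *)
Definition inv_pow (k : R) (n : nat) : R := exp (- (k * ln (INR n))).

Lemma sum_inv_pow_le (k : R) (N : nat) : 1 < k ->
  sum_n (fun i => inv_pow k i.+1) N <= 1 + / (k - 1).
Proof.
move=> k1; pose d := k - 1.
have d0 : 0 < d by rewrite /d; lra.
(* The primitive [- y^(-d) / d] of [y^(-d-1)], taken at the integers. *)
pose g (i : nat) := - (/ d * exp (- (d * ln (INR i.+1)))).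
have h i : inv_pow k i.+2 <= g i.+1 - g i.
  have i1 := INR_ge1 i; rewrite /g /inv_pow !(S_INR i.+1).
  set n := INR i.+1 + 1; have n2 : 2 <= n by rewrite /n; lra.
  have -> : INR i.+1 = n - 1 by rewrite /n; ring.
  have l := inv_le_ln_sub n ltac:(lra).
  have -> : - (k * ln n) = - (d * ln n) + - ln n by rewrite /d; ring.
  have -> : - (d * ln (n - 1)) = - (d * ln n) + d * (ln n - ln (n - 1)) by ring.
  rewrite !exp_plus (exp_Ropp (ln n)) exp_ln; last lra.
  have e := exp_ineq1_le (d * (ln n - ln (n - 1))).
  have p := exp_pos (- (d * ln n)).
  have -> : forall P Q, - (/ d * P) - - (/ d * (P * Q)) = P * (/ d * (Q - 1)) by move=> P Q; ring.
  apply: Rmult_le_compat_l; first lra.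
  apply: (Rmult_le_reg_l d) => //.
  rewrite -Rmult_assoc Rinv_r ?Rmult_1_l; last lra.
  have := Rmult_le_compat_l d _ _ (Rlt_le _ _ d0) l; lra.
have := sum_n_le_telescope (fun i => inv_pow k i.+1) g h N.
rewrite /g /inv_pow /= ln_1 !Rmult_0_r Ropp_0 exp_0 -/d.
have := Rmult_lt_0_compat _ _ (Rinv_0_lt_compat _ d0) (exp_pos (- (d * ln (INR N.+1)))).
rewrite /=; lra.
Qed.

Lemma sum_harmonic_le (m N : nat) : (0 < m)%N ->
  sum_n (fun i => if (i < m)%N then / INR i.+1 else 0) N <= 1 + ln (INR m).
Proof.
case: m => // m _.
(* The minimum with [m] freezes the primitive [ln] at the cutoff, which makes the bound independent
   of [N]. *)
have h (i : nat) : (if (i.+1 < m.+1)%N then / INR i.+2 else 0) <=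
    ln (INR (minn i.+1 m).+1) - ln (INR (minn i m).+1).
  have i1 := INR_ge1 i; case: ltnP => im.
    have -> : minn i.+1 m = i.+1 by apply/minn_idPl.
    have -> : minn i m = i by apply/minn_idPl; apply: ltnW.
    rewrite (S_INR i.+1); have := inv_le_ln_sub (INR i.+1 + 1) ltac:(lra).
    have -> : INR i.+1 + 1 - 1 = INR i.+1 by ring.
    lra.
  have -> : minn i.+1 m = m by apply/minn_idPr; apply: leqW.
  have -> : minn i m = m by apply/minn_idPr.
  lra.
have := sum_n_le_telescope (fun i => if (i < m.+1)%N then / INR i.+1 else 0)
  (fun i => ln (INR (minn i m).+1)) h N.
rewrite min0n /= ln_1 Rinv_1.
suff : ln (INR (minn N m).+1) <= ln (INR m.+1) by rewrite /=; lra.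
apply: ln_le; first by have := INR_ge1 (minn N m); lra.
apply: le_INR; apply/leP; rewrite ltnS; exact: geq_minr.
Qed.

Lemma sum_inv_dist_below_le (m N : nat) : (1 < m)%N ->
  sum_n (fun i => if (i < m)%N then / (INR m + / 2 - INR i.+1) else 0) N
  <= 3 + ln 2 + ln (INR m).
Proof.
move=> m1; have m2 : 2 <= INR m by have /leP/le_INR := m1.
set f := (X in sum_n X N).
(* Minus the logarithm of the distance to the next integer. The last term, at distance [1/2], equals
   2 and lifts [g] from [- ln (1/2) = ln 2] to its final value [2 + ln 2]. *)
pose g (i : nat) := if (i.+1 < m)%N then - ln (INR m + / 2 - INR i.+2) else 2 + ln 2.
have ln2 : ln (/ 2) = - ln 2 by apply: ln_Rinv; lra.
have h i : f i.+1 <= g i.+1 - g i.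
  rewrite /f /g; case: (ltnP i.+2 m) => i2.
    have -> : (i.+1 < m)%N by apply: ltnW.
    have /leP/le_INR := i2; rewrite !S_INR => i3.
    have := inv_le_ln_sub (INR m + / 2 - (INR i + 1 + 1)) ltac:(lra).
    have -> : INR m + / 2 - (INR i + 1 + 1) - 1 = INR m + / 2 - (INR i + 1 + 1 + 1) by ring.
    lra.
  case: (ltnP i.+1 m) => i1; last lra.
  have -> : m = i.+2 by apply/eqP; rewrite eqn_leq i1 i2.
  have -> : INR i.+2 + / 2 - INR i.+2 = / 2 by ring.
  rewrite ln2 Rinv_inv; lra.
have := sum_n_le_telescope f g h N.
have -> : f 0%N = / (INR m - / 2).
  rewrite /f (ltnW m1) /=; congr Rinv; lra.
have -> : g 0%N = - ln (INR m - 3 / 2) by rewrite /g m1 /=; congr (- ln _); lra.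
have : / (INR m - / 2) <= 1 by rewrite -Rinv_1; apply: Rinv_le_contravar; lra.
have l : ln (INR m - 3 / 2) <= ln (INR m) by apply: ln_le; lra.
suff : g N <= 2 + ln 2 by lra.
rewrite /g; case: ltnP => Nm; last lra.
have /leP/le_INR := Nm; rewrite !S_INR => N3.
have : ln (/ 2) <= ln (INR m + / 2 - (INR N + 1 + 1)) by apply: ln_le; lra.
lra.
Qed.

(** With [y = m + 1/2], subtracting [1 / n] leaves the summable term [y / (n (n - y))], hence a
    bound valid for all [N]. *)
Lemma sum_inv_dist_above_le (m N : nat) : (0 < m)%N ->
  sum_n (fun i => if (i < m)%N then 0 else
     / (INR i.+1 - (INR m + / 2)) - / INR i.+1) N <= 2 + ln (2 * INR m + 2).
Proof.
move=> m0; have m1 : 1 <= INR m by have /leP/le_INR := m0.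
set f := (X in sum_n X N).
pose h (n : R) := ln (n - (INR m + / 2)) - ln n.
(* The primitive [h n = ln ((n - y) / n)] is shifted so that [g] jumps from 0 to 2 at [n = m + 1],
   where the term is less than 2. *)
pose g (i : nat) := if (i < m)%N then 0 else 2 + ln (2 * INR m + 2) + h (INR i.+1).
have ln2 : ln (2 * INR m + 2) = - h (INR m + 1).
  rewrite /h; have -> : INR m + 1 - (INR m + / 2) = / 2 by lra.
  have -> : 2 * INR m + 2 = 2 * (INR m + 1) by ring.
  rewrite ln_Rinv ?ln_mult; lra.
have H i : f i.+1 <= g i.+1 - g i.
  rewrite /f /g; case: (ltnP i.+1 m) => i1.
    by rewrite (ltnW i1); lra.
  case: (ltnP i m) => im.
    have -> : m = i.+1 by apply/eqP; rewrite eqn_leq im i1.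
    move: ln2; have -> : m = i.+1 by apply/eqP; rewrite eqn_leq im i1.
    rewrite -S_INR => ->; rewrite (S_INR i.+1).
    have -> : INR i.+1 + 1 - (INR i.+1 + / 2) = / 2 by lra.
    rewrite Rinv_inv; have := Rinv_0_lt_compat (INR i.+1 + 1).
    have := INR_ge1 i; lra.
  have /leP/le_INR i2 := im.
  rewrite (S_INR i.+1) (S_INR i).
  set n := INR i + 1 + 1; set y := INR m + / 2.
  have -> : INR i + 1 = n - 1 by rewrite /n; ring.
  have ny : 0 < n - 1 - y by rewrite /n /y; lra.
  have y0 : 0 < y by rewrite /y; lra.
  rewrite /h -/y.
  (* [h n - h (n - 1)] is the difference of the logarithms of these two products, which differ by
     exactly [y]. *)
  have := ln_sub_ge ((n - y) * (n - 1)) ((n - 1 - y) * n) ltac:(nra) ltac:(nra).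
  rewrite !ln_mult; try lra.
  have -> : ((n - y) * (n - 1) - (n - 1 - y) * n) / ((n - y) * (n - 1))
    = y / (n - y) * / (n - 1) by field; split; lra.
  have -> : / (n - y) - / n = y / (n - y) * / n by field; split; lra.
  have : y / (n - y) * / n <= y / (n - y) * / (n - 1).
    apply: Rmult_le_compat_l; first by left; apply: Rdiv_lt_0_compat; lra.
    by apply: Rinv_le_contravar; lra.
  lra.
have := sum_n_le_telescope f g H N.
have -> : f 0%N = 0 by rewrite /f m0.
have -> : g 0%N = 0 by rewrite /g m0.
suff : g N <= 2 + ln (2 * INR m + 2) by lra.
have l0 : 0 <= ln (2 * INR m + 2) by rewrite -ln_1; apply: ln_le; lra.
rewrite /g; case: ltnP => Nm; first lra.
have /leP/le_INR N2 := Nm; rewrite S_INR /h.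
have : ln (INR N + 1 - (INR m + / 2)) <= ln (INR N + 1) by apply: ln_le; lra.
lra.
Qed.

(** [(x / n)^k / |ln (x / n)|]: the error in [perron_bound] at [L = ln (x / n)], without its factor
    [2 / T]. *)
Definition perron_weight (k x : R) (n : nat) : R :=
  exp (k * (ln x - ln (INR n))) / Rabs (ln x - ln (INR n)).

(** The abscissa [k = 1 + 1 / ln x] is chosen so that [x^k = e x]. *)
Lemma exp_perron_split (x n : R) : 0 < ln x ->  0 < x ->
  exp ((1 + / ln x) * (ln x - ln n)) = exp 1 * x * exp (- ((1 + / ln x) * ln n)).
Proof.
move=> lx x0.
have -> : (1 + / ln x) * (ln x - ln n) = 1 + (ln x + - ((1 + / ln x) * ln n)).
  by field; lra.
by rewrite !exp_plus (exp_ln x) // Rmult_assoc.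
Qed.

Lemma inv_pow_pos (k : R) (n : nat) : 0 < inv_pow k n.
Proof. exact: exp_pos. Qed.

Lemma inv_pow_le_inv (k : R) (i : nat) : 1 <= k -> inv_pow k i.+1 <= / INR i.+1.
Proof.
move=> k1; have n1 := INR_ge1 i; rewrite /inv_pow.
have -> : / INR i.+1 = exp (- ln (INR i.+1)) by rewrite exp_Ropp exp_ln //; lra.
have l : 0 <= ln (INR i.+1) by rewrite -ln_1; apply: ln_le; lra.
have : - (k * ln (INR i.+1)) <= - ln (INR i.+1) by nra.
case=> [h|->]; [left; exact: exp_increasing|exact: Rle_refl].
Qed.

(** For [n < x], [n^(-k) <= 1 / n] and [x / (n (x - n)) = 1 / n + 1 / (x - n)]. For [n > x],
    [n / (n - x) = 1 + x / (n - x)]: the summand 1 keeps the convergent weight [n^(-k)], and only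
    the other part uses [n^(-k) <= 1 / n]. *)
Lemma perron_weight_le (m i : nat) : (1 < m)%N -> let x := INR m + / 2 in
  perron_weight (1 + / ln x) x i.+1 <=
  exp 1 * x * (inv_pow (1 + / ln x) i.+1 + ((if (i < m)%N then / INR i.+1 else 0)
    + ((if (i < m)%N then / (x - INR i.+1) else 0)
    + (if (i < m)%N then 0 else / (INR i.+1 - x) - / INR i.+1)))).
Proof.
move=> m1 x; have m2 : 2 <= INR m by have /leP/le_INR := m1.
have x2 : 2 < x by rewrite /x; lra.
have lx := ln_half_le x x2; have lx0 : 0 < / ln x by apply: Rinv_0_lt_compat; lra.
have n1 := INR_ge1 i; set n := INR i.+1 in n1 *.
rewrite /perron_weight -/n exp_perron_split; [|lra|lra].
rewrite -/n -[exp (- _)]/(inv_pow (1 + / ln x) i.+1).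
have p0 := inv_pow_pos (1 + / ln x) i.+1.
have pn : inv_pow (1 + / ln x) i.+1 <= / n by apply: inv_pow_le_inv; lra.
set p := inv_pow _ _ in p0 pn *.
rewrite /Rdiv !Rmult_assoc; do 2 (apply: Rmult_le_compat_l; first by have := exp_pos 1; lra).
case: (ltnP i m) => im.
- have nm : n <= INR m by apply: le_INR; apply/leP.
  have xn : 0 < x - n by rewrite /x; lra.
  have D := ln_sub_ge x n ltac:(lra) ltac:(lra).
  have D0 : 0 < (x - n) / x by apply: Rdiv_lt_0_compat; lra.
  rewrite Rabs_pos_eq; last lra.
  apply: (Rle_trans _ (/ n * / ((x - n) / x))).
    apply: Rmult_le_compat => //; [lra| |apply: Rinv_le_contravar => //].
    by left; apply: Rinv_0_lt_compat; lra.
  have -> : / n * / ((x - n) / x) = / n + / (x - n) by field; split; lra.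
  lra.
- have nm : INR m + 1 <= n by rewrite -S_INR; apply: le_INR; apply/leP.
  have xn : 0 < n - x by rewrite /x; lra.
  have D := ln_sub_ge n x ltac:(lra) ltac:(lra).
  have D0 : 0 < (n - x) / n by apply: Rdiv_lt_0_compat; lra.
  rewrite Rabs_minus_sym Rabs_pos_eq; last lra.
  apply: (Rle_trans _ (p * / ((n - x) / n))).
    apply: Rmult_le_compat_l; first lra.
    by apply: Rinv_le_contravar.
  have -> : p * / ((n - x) / n) = p + p * (x / (n - x)) by field; split; lra.
  have : p * (x / (n - x)) <= / n * (x / (n - x)).
    by apply: Rmult_le_compat_r => //; left; apply: Rdiv_lt_0_compat; lra.
  have -> : / n * (x / (n - x)) = / (n - x) - / n by field; split; lra.
  lra.
Qed.

Lemma sum_n_Rplus (f g : nat -> R) (N : nat) :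
  sum_n (fun i => f i + g i) N = sum_n f N + sum_n g N.
Proof. exact: (sum_n_plus (G := R_AbelianMonoid)). Qed.

Lemma sum_n_Rmult_l (c : R) (f : nat -> R) (N : nat) :
  sum_n (fun i => c * f i) N = c * sum_n f N.
Proof. exact: (sum_n_mult_l (K := R_Ring)). Qed.

Lemma sum_perron_weight_le (m N : nat) : (1 < m)%N -> let x := INR m + / 2 in
  sum_n (fun i => perron_weight (1 + / ln x) x i.+1) N <= 21 * exp 1 * (x * ln x).
Proof.
move=> m1 x; have m2 : 2 <= INR m by have /leP/le_INR := m1.
have x2 : 2 < x by rewrite /x; lra.
have lx := ln_half_le x x2; have lx0 : 0 < / ln x by apply: Rinv_0_lt_compat; lra.
apply: Rle_trans (sum_n_Rle _ _ N (fun i _ => perron_weight_le m i m1)) _.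
rewrite -/x sum_n_Rmult_l !sum_n_Rplus.
have A := sum_inv_pow_le (1 + / ln x) N ltac:(lra).
have B := sum_harmonic_le m N (ltnW m1).
have C := sum_inv_dist_below_le m N m1.
have D := sum_inv_dist_above_le m N (ltnW m1).
rewrite -/x in C D.
have e : / (1 + / ln x - 1) = ln x by field; lra.
rewrite e in A.
have l1 : ln (INR m) <= ln x by apply: ln_le; rewrite /x; lra.
have l2 : ln 2 <= ln x by apply: ln_le; lra.
have l3 : ln (2 * INR m + 2) <= 3 * ln x.
  have -> : 3 * ln x = ln (x * x * x) by rewrite !ln_mult; nra.
  apply: ln_le; first lra.
  have -> : 2 * INR m + 2 = 2 * x + 1 by rewrite /x; lra.
  nra.
(* The four sums add up to at most [7 + 7 ln x], and [7 < 14 ln x] because [ln x > 1/2]. *)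
have -> : 21 * exp 1 * (x * ln x) = exp 1 * x * (21 * ln x) by ring.
apply: Rmult_le_compat_l; last lra.
by apply: Rmult_le_pos; [left; apply: exp_pos|lra].
Qed.

(** * Prime powers *)

Lemma sum_n_truncate (f : nat -> R) (m N : nat) : (0 < m)%N -> (m <= N.+1)%N ->
  sum_n (fun i => if (i < m)%N then f i else 0) N = sum_n f m.-1.
Proof.
case: m => // m _; rewrite ltnS => /=.
elim: N => [|N IH] mN.
  by move: mN; rewrite leqn0 => /eqP ->; rewrite !sum_O.
move: mN; rewrite leq_eqVlt => /orP[/eqP ->|mN].
  by apply: sum_n_ext_loc => i /leP iN; rewrite ltnS iN.
rewrite sum_Sn IH // ltnS leqNgt mN /= /plus /=; ring.
Qed.

Lemma sum_n_Rminus (f g : nat -> R) (N : nat) :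
  sum_n (fun i => f i - g i) N = sum_n f N - sum_n g N.
Proof.
elim: N => [|N IH]; first by rewrite !sum_O.
rewrite !sum_Sn IH /plus /=; ring.
Qed.

Lemma sum_n_nonneg (f : nat -> R) (N : nat) : (forall i, 0 <= f i) -> 0 <= sum_n f N.
Proof.
move=> f0; elim: N => [|N IH]; first by rewrite sum_O.
by rewrite sum_Sn /plus /=; apply: Rplus_le_le_0_compat.
Qed.

Lemma sum_n_ge_term (f : nat -> R) (N j : nat) :
  (forall i, 0 <= f i) -> (j <= N)%N -> f j <= sum_n f N.
Proof.
move=> f0; elim: N => [|N IH] jN.
  by move: jN; rewrite leqn0 => /eqP ->; rewrite sum_O; lra.
rewrite sum_Sn /plus /=; move: jN; rewrite leq_eqVlt => /orP[/eqP ->|jN].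
  have := sum_n_nonneg f N f0; lra.
have := IH jN; have := f0 N.+1; lra.
Qed.

Lemma log_zeta_coef_bounds (n : nat) : 0 <= log_zeta_coef n <= 1.
Proof.
rewrite /log_zeta_coef; case E: (primes n) => [|p [|q s]]; try lra.
have : (0 < logn p n)%N by rewrite logn_gt0 E mem_head.
case: (logn p n) => // k _; have := INR_ge1 k => k1; split.
  by left; apply: Rinv_0_lt_compat; lra.
by rewrite -Rinv_1; apply: Rinv_le_contravar; lra.
Qed.

Lemma log_zeta_coef_prime (p : nat) : prime p -> log_zeta_coef p = 1.
Proof.
by move=> pp; have := log_zeta_coef_prime_power pp (ltn0Sn 0); rewrite expn1 Rinv_1.
Qed.

Definition prime_ind (n : nat) : R := if prime n then 1 else 0.

(** The list runs from 0 to [m + 1], and 0 is not prime, so the sum may start at 1. *)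
Lemma count_prime_sum (m : nat) :
  INR (count prime (iota 0 m.+2)) = sum_n (fun i => prime_ind i.+1) m.
Proof.
elim: m => [|m IH]; first by rewrite sum_O.
rewrite sum_Sn -IH -(addn1 m.+2) iotaD count_cat plus_INR /plus /= addn0 /prime_ind.
by case: (prime _); rewrite ?addn0 ?addn1.
Qed.

Lemma prime_pi_half_odd (m : nat) : (0 < m)%N ->
  INR (prime_pi (INR m + / 2)) = sum_n (fun i => prime_ind i.+1) m.-1.
Proof.
case: m => // m _; rewrite -count_prime_sum /prime_pi.
have -> : up (INR m.+1 + / 2) = Z.of_nat m.+2.
  symmetry; apply: tech_up; rewrite -INR_IZR_INZ (S_INR m.+1); lra.
by rewrite Znat.Nat2Z.id.
Qed.

Definition eq_ind_R (a b : nat) : R := if a == b then 1 else 0.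

Lemma eq_ind_R_nonneg (a b : nat) : 0 <= eq_ind_R a b.
Proof. rewrite /eq_ind_R; case: eqP => _; lra. Qed.

Lemma sum_eq_ind_R_le1 (c M : nat) : sum_n (fun i => eq_ind_R i.+1 c) M <= 1.
Proof.
(* Strengthened for the induction: nothing is counted while [c] lies beyond the range. *)
suff : sum_n (fun i => eq_ind_R i.+1 c) M <= (if (c <= M.+1)%N then 1 else 0).
  case: ifP => _; lra.
rewrite /eq_ind_R; elim: M => [|M IH].
  by rewrite sum_O; case: eqP => [<-|_]; [rewrite leqnn; lra|case: ifP => _; lra].
rewrite sum_Sn /plus /=; case: eqP IH => [<-|ne] IH.
  by move: IH; rewrite leqnn ltnn; lra.
rewrite Rplus_0_r; apply: Rle_trans IH _.
case: ifP => h1; first by rewrite leqW //; lra.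
case: ifP => _; lra.
Qed.

Definition proper_power_majorant (K r n : nat) : R :=
  sum_n (fun j => / INR j.+2 * sum_n (fun q => eq_ind_R n (q ^ j.+2)%N) r) K.

(** At a prime the difference is 0. At [n = p^(j+2)] the single pair [(j, p)] of the majorant
    suffices: it is in range since [p^2 <= n <= m < (r + 1)^2] and [2^(j+2) <= n <= m]. *)
Lemma log_zeta_coef_sub_prime_le (m r n : nat) :
  (0 < n <= m)%N -> (m < r.+1 * r.+1)%N ->
  0 <= log_zeta_coef n - prime_ind n <= proper_power_majorant (trunc_log 2 m) r n.
Proof.
move=> /andP[n0 nm] mr.
have w0 j : 0 < / INR j.+2 by apply: Rinv_0_lt_compat; have := INR_ge1 j.+1; lra.
have inner0 j : 0 <= sum_n (fun q => eq_ind_R n (q ^ j.+2)%N) r.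
  by apply: sum_n_nonneg => q; apply: eq_ind_R_nonneg.
have term0 j : 0 <= / INR j.+2 * sum_n (fun q => eq_ind_R n (q ^ j.+2)%N) r.
  by apply: Rmult_le_pos => //; left.
have M0 : 0 <= proper_power_majorant (trunc_log 2 m) r n by apply: sum_n_nonneg.
rewrite /prime_ind; case: (boolP (prime n)) => [pn|npn].
  by rewrite log_zeta_coef_prime //; lra.
rewrite Rminus_0_r; have [a0 _] := log_zeta_coef_bounds n; split => //.
move: M0; rewrite /log_zeta_coef.
case E: (primes n) => [|p [|q s]] // _.
have pin : p \in primes n by rewrite E mem_head.
have pp : prime p by move: pin; rewrite mem_primes => /andP[].
have k0 : (0 < logn p n)%N by rewrite logn_gt0.
have nE : n = (p ^ logn p n)%N.
  by rewrite {1}(prod_prime_decomp n0) prime_decompE E /= big_seq1.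
case: (logn p n) k0 nE => // [] [|j] _ nE.
  by move: npn; rewrite nE expn1 pp.
have p1 := prime_gt1 pp.
have jK : (j <= trunc_log 2 m)%N.
  apply: (@leq_trans j.+2); first by rewrite ltnW.
  apply: trunc_log_max => //; apply: leq_trans nm; rewrite nE.
  by rewrite leq_exp2r.
have pr : (p <= r)%N.
  rewrite -ltnS -ltn_sqr -(mulnn r.+1); apply: leq_ltn_trans mr; apply: leq_trans nm.
  by rewrite nE leq_exp2l.
apply: Rle_trans (sum_n_ge_term _ _ j term0 jK).
rewrite -[X in X <= _]Rmult_1_r; apply: Rmult_le_compat_l; first by left.
apply: Rle_trans (sum_n_ge_term _ _ p _ pr).
  by rewrite {1}nE /eq_ind_R eqxx; lra.
by move=> q; apply: eq_ind_R_nonneg.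
Qed.

Lemma sum_inv_le_ln (K : nat) : sum_n (fun j => / INR j.+2) K <= ln (INR K.+2).
Proof.
have h i : / INR i.+3 <= ln (INR i.+3) - ln (INR i.+2).
  rewrite (S_INR i.+2); have i1 := INR_ge1 i.+1.
  have := inv_le_ln_sub (INR i.+2 + 1) ltac:(lra).
  by have -> : INR i.+2 + 1 - 1 = INR i.+2 by ring.
have := sum_n_le_telescope (fun j => / INR j.+2) (fun j => ln (INR j.+2)) h K.
have -> : INR 2 = 2 by []; have := ln_lt_2; lra.
Qed.

(** After exchanging the sums, each pair [(q, j)] meets at most one [n]; there are [r + 1] bases,
    and the weights sum to a logarithm. *)
Lemma sum_proper_power_majorant_le (K r M : nat) :
  sum_n (fun i => proper_power_majorant K r i.+1) M <= INR r.+1 * ln (INR K.+2).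
Proof.
rewrite /proper_power_majorant.
rewrite (sum_n_switch (G := R_AbelianMonoid)
  (fun i j => / INR j.+2 * sum_n (fun q => eq_ind_R i.+1 (q ^ j.+2)%N) r)).
apply: (Rle_trans _ (sum_n (fun j => INR r.+1 * / INR j.+2) K)); last first.
  rewrite sum_n_Rmult_l; apply: Rmult_le_compat_l (sum_inv_le_ln K); exact: pos_INR.
apply: sum_n_Rle => j _; rewrite sum_n_Rmult_l Rmult_comm.
apply: Rmult_le_compat_r.
  by left; apply: Rinv_0_lt_compat; have := INR_ge1 j.+1; lra.
rewrite (sum_n_switch (G := R_AbelianMonoid) (fun i q => eq_ind_R i.+1 (q ^ j.+2)%N)).
apply: Rle_trans (sum_n_Rle _ (fun=> 1) r (fun q _ => sum_eq_ind_R_le1 _ M)) _.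
by rewrite sum_n_const Rmult_1_r; lra.
Qed.

Lemma prime_power_sum_sub_prime_pi (m : nat) : (1 < m)%N -> let x := INR m + / 2 in
  0 <= sum_n (fun i => log_zeta_coef i.+1) m.-1 - INR (prime_pi x)
    <= 2 * sqrt x * (ln 6 + ln (ln x)).
Proof.
move=> m1 x; have m2 : 2 <= INR m by have /leP/le_INR := m1.
have x2 : 2 < x by rewrite /x; lra.
have lx := ln_half_le x x2.
have [r1 r2] := PeanoNat.Nat.sqrt_spec m (PeanoNat.Nat.le_0_l m); set r := PeanoNat.Nat.sqrt m in r1 r2.
rewrite prime_pi_half_odd ?(ltnW m1) //.
set S := (X in 0 <= X <= _).
have -> : S = sum_n (fun i => log_zeta_coef i.+1 - prime_ind i.+1) m.-1.
  by rewrite sum_n_Rminus.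
have H i : (i <= m.-1)%N -> 0 <= log_zeta_coef i.+1 - prime_ind i.+1
    <= proper_power_majorant (trunc_log 2 m) r i.+1.
  move=> im; apply: log_zeta_coef_sub_prime_le.
    by rewrite /= -(prednK (ltnW m1)).
  by apply/ltP; exact: r2.
split.
  apply: (Rle_trans _ (sum_n (fun=> 0) m.-1)); first by rewrite sum_n_const; lra.
  by apply: sum_n_Rle => i /H; case.
apply: Rle_trans (sum_n_Rle _ _ _ (fun i im => proj2 (H i im))) _.
apply: Rle_trans (sum_proper_power_majorant_le _ _ _) _.
have s1 : 1 <= sqrt x by rewrite -sqrt_1; apply: sqrt_le_1; lra.
apply: Rmult_le_compat; first exact: pos_INR.
- by rewrite -ln_1; apply: ln_le; [lra|exact: INR_ge1].
(* [r + 1 <= 2 sqrt x], because [1 <= sqrt x]. *)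
- rewrite S_INR; suff : INR r <= sqrt x by lra.
  rewrite -(sqrt_square (INR r)); last exact: pos_INR.
  apply: sqrt_le_1; [|lra|].
    by apply: Rmult_le_pos; apply: pos_INR.
  by rewrite -mult_INR; move/le_INR: r1; rewrite /x; lra.
- rewrite -ln_mult; [|lra|lra].
  apply: ln_le; first by have := INR_ge1 (trunc_log 2 m).+1; lra.
  set K := trunc_log 2 m; rewrite !S_INR.
  have /leP/le_INR : (2 ^ K <= m)%N by apply: trunc_logP => //; apply: ltnW.
  have -> : INR (2 ^ K) = 2 ^ K.
    by elim: K => [|K IH] //; rewrite expnS mult_INR IH.
  move=> h; have : ln (2 ^ K) <= ln x.
    by apply: ln_le; [apply: pow_lt; lra|rewrite /x; lra].
  rewrite ln_pow; last lra.
  (* [K ln 2 <= ln x] with [ln 2 > 1/2] gives [K <= 2 ln x], and [2 <= 4 ln x]; hence the 6. *)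
  have := ln_lt_2; have := pos_INR K; nra.
Qed.

Lemma half_odd_nat (x : R) : half_odd x -> 2 < x ->
  exists2 m : nat, (1 < m)%N & x = INR m + / 2.
Proof.
case=> z -> h; have z1 : (1 < z)%Z by apply: lt_IZR; lra.
exists (Z.to_nat z); first by apply/ltP; lia.
by rewrite INR_IZR_INZ Znat.Z2Nat.id; [lra|lia].
Qed.

(* [ln (ln x)] vanishes at [x = e], which lies strictly between the half-odd
   integers [5/2] and [7/2]. *)
Lemma ln_ln_half_odd_bounded_below :
  exists2 c, 0 < c & forall m : nat, (1 < m)%N -> 1 <= c * Rabs (ln (ln (INR m + / 2))).
Proof.
have e1 : 5 / 2 < exp 1.
  (* [e^(1/6) >= 7/6], and [(7/6)^6] already exceeds [5/2]. *)
  have -> : exp 1 = (exp (/ 6)) ^ 6.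
    by rewrite /= Rmult_1_r -!exp_plus; congr exp; field.
  have h := exp_ineq1_le (/ 6).
  apply: Rlt_le_trans (pow_incr (7 / 6) _ 6 _); lra.
have l5 : / 2 < ln (5 / 2) < 1.
  split; first by apply: ln_half_le; lra.
  by rewrite -(ln_exp 1); apply: ln_increasing; lra.
have l7 : 1 < ln (7 / 2).
  rewrite -(ln_exp 1); apply: ln_increasing; first exact: exp_pos.
  have := exp_le_3; lra.
have a0 : ln (ln (5 / 2)) < 0 by rewrite -ln_1; apply: ln_increasing; lra.
have b0 : 0 < ln (ln (7 / 2)) by rewrite -ln_1; apply: ln_increasing; lra.
pose a := - ln (ln (5 / 2)); pose b := ln (ln (7 / 2)).
have ia : 0 < / a by apply: Rinv_0_lt_compat; rewrite /a; lra.
have ib : 0 < / b by apply: Rinv_0_lt_compat; rewrite /b; lra.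
(* [1 / a] serves [m = 2], where [ln (ln x) = - a]; [1 / b] serves [m >= 3], where
   [ln (ln x) >= b]. *)
exists (/ a + / b) => [|m]; first lra.
rewrite leq_eqVlt => /orP[/eqP <-|m2].
  have -> : INR 2 + / 2 = 5 / 2 by rewrite /=; lra.
  rewrite Rabs_left // -/a.
  have : / a * a = 1 by rewrite Rinv_l //; rewrite /a; lra.
  have : 0 < / b * a by apply: Rmult_lt_0_compat => //; rewrite /a; lra.
  lra.
have /leP/le_INR := m2; have -> : INR 3 = 3 by rewrite /=; lra.
move=> m3; have h : b <= ln (ln (INR m + / 2)).
  by apply: ln_le; [lra|apply: ln_le; lra].
rewrite Rabs_pos_eq; last by rewrite /b in h; lra.
have : / b * b = 1 by rewrite Rinv_l //; rewrite /b; lra.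
have := Rmult_le_compat_l _ _ _ (Rlt_le _ _ ib) h.
have := Rmult_lt_0_compat _ _ ia b0; have := Rmult_le_compat_l _ _ _ (Rlt_le _ _ ia) h.
rewrite -/b; lra.
Qed.

(** * Termwise integration *)

Lemma Rcpow_pair (x k t : R) :
  Rcpow x (k, t) = (exp (k * ln x) * cos (t * ln x), exp (k * ln x) * sin (t * ln x)).
Proof.
rewrite /Rcpow /Cexp /=.
have -> : k * ln x - t * 0 = k * ln x by ring.
by have -> : k * 0 + t * ln x = t * ln x by ring.
Qed.

Lemma Rcpow_div_pair (x k t : R) : 0 < k ->
  (Rcpow x (k, t) / (k, t))%C = (perron_re k (ln x) t, perron_im k (ln x) t).
Proof.
move=> k0; have p := sum_sqr_pos k t (Rgt_not_eq _ _ k0).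
rewrite Rcpow_pair /Cdiv /Cinv /Cmult /perron_re /perron_im /=.
congr pair; field; lra.
Qed.

Lemma log_zeta_term_pair (k t : R) (n : nat) : log_zeta_term (k, t) n =
  (log_zeta_coef n * (inv_pow k n * cos (t * ln (INR n))),
   - (log_zeta_coef n * (inv_pow k n * sin (t * ln (INR n))))).
Proof.
rewrite /log_zeta_term (_ : (- (k, t))%C = (- k, - t)) // Rcpow_pair /Cmult /inv_pow /=.
rewrite !Ropp_mult_distr_l_reverse cos_neg sin_neg.
congr pair; ring.
Qed.

Lemma perron_term (x k t : R) (n : nat) : 0 < k ->
  (Rcpow x (k, t) / (k, t) * log_zeta_term (k, t) n)%C =
  (log_zeta_coef n * perron_re k (ln x - ln (INR n)) t,
   log_zeta_coef n * perron_im k (ln x - ln (INR n)) t).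
Proof.
move=> k0; have p := sum_sqr_pos k t (Rgt_not_eq _ _ k0).
rewrite Rcpow_div_pair // log_zeta_term_pair /Cmult /perron_re /perron_im /inv_pow /=.
have -> y z : t * (y - z) = t * y - t * z by ring.
have -> y z : k * (y - z) = k * y + - (k * z) by ring.
rewrite exp_plus cos_minus sin_minus.
congr pair; field; lra.
Qed.

(** [log_zeta] is a pair of real series, so its partial sums are pairs of real sums; the factor
    [x^s / s] is distributed over them here. *)
Lemma perron_partial_sum (x k t : R) (N : nat) : 0 < k ->
  (Rcpow x (k, t) / (k, t) *
    (sum_n (fun i => Re (log_zeta_term (k, t) i.+1)) N,
     sum_n (fun i => Im (log_zeta_term (k, t) i.+1)) N))%C =
  (sum_n (fun i => log_zeta_coef i.+1 * perron_re k (ln x - ln (INR i.+1)) t) N,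
   sum_n (fun i => log_zeta_coef i.+1 * perron_im k (ln x - ln (INR i.+1)) t) N).
Proof.
move=> k0; elim: N => [|N IH].
  by rewrite !sum_O -(perron_term x k t 1 k0); congr Cmult; case: log_zeta_term.
rewrite !sum_Sn; move: (perron_term x k t N.+2 k0) IH.
move: (sum_n _ N) (sum_n _ N) (sum_n _ N) (sum_n _ N) => A B U V.
case: (log_zeta_term _ _) => c d; case: (Rcpow _ _ / _)%C => a b.
rewrite /Cmult /plus [Re _]/= [Im _]/= [in X in X -> _]/= [in X in _ -> X -> _]/=.
move=> -[<- <-] [<- <-] /=; congr pair; ring.
Qed.

(** The tail estimate of the Weierstrass test: a majorant free of [t] makes the convergence uniform
    in [t]. *)
Lemma Series_sub_sum_n_le (u b : nat -> R) (N : nat) :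
  (forall i, Rabs (u i) <= b i) -> ex_series b ->
  Rabs (Series u - sum_n u N) <= Series b - sum_n b N.
Proof.
move=> ub eb.
have eu : ex_series u by apply: (ex_series_le (V := R_CompleteNormedModule)) ub eb.
have tail (v : nat -> R) : ex_series v ->
    Series v - sum_n v N = Series (fun i => v (N.+1 + i)%N).
  move=> ev; rewrite (Series_incr_n v N.+1) //; last by apply/ltP.
  by rewrite -sum_n_Reals Rplus_comm /Rminus Rplus_assoc Rplus_opp_r Rplus_0_r.
have eb' : ex_series (fun i => b (N.+1 + i)%N) by apply/(ex_series_incr_n b N.+1).
rewrite !tail //; apply: Rle_trans (Series_Rabs _ _) _.
  apply: (ex_series_le (V := R_CompleteNormedModule)) eb' => i.
  by rewrite /norm /= /abs /= Rabs_Rabsolu.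
by apply: Series_le => // i; split; [apply: Rabs_pos|].
Qed.

Lemma ex_series_inv_pow (k : R) : 1 < k -> ex_series (fun i => inv_pow k i.+1).
Proof.
move=> k1.
have [l hl] : ex_finite_lim_seq (sum_n (fun i => inv_pow k i.+1)).
  apply: (ex_finite_lim_seq_incr _ (1 + / (k - 1))) => N.
    by rewrite sum_Sn /plus /=; have := inv_pow_pos k N.+2; lra.
  exact: sum_inv_pow_le.
by exists l.
Qed.

Lemma log_zeta_term_bound (k t : R) (n : nat) :
  Rabs (Re (log_zeta_term (k, t) n)) <= inv_pow k n /\
  Rabs (Im (log_zeta_term (k, t) n)) <= inv_pow k n.
Proof.
rewrite log_zeta_term_pair /=; have [a0 a1] := log_zeta_coef_bounds n.
have p0 := inv_pow_pos k n.
have B y : -1 <= y <= 1 -> Rabs (log_zeta_coef n * (inv_pow k n * y)) <= inv_pow k n.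
  move=> y1; rewrite !Rabs_mult (Rabs_pos_eq _ a0) (Rabs_pos_eq (inv_pow _ _)); last lra.
  have ya : Rabs y <= 1 by apply: Rabs_le.
  have := Rmult_le_compat_l _ _ _ (Rlt_le _ _ p0) ya.
  have q0 := Rmult_le_pos _ _ (Rlt_le _ _ p0) (Rabs_pos y).
  have := Rmult_le_compat_r _ _ _ q0 a1; lra.
by rewrite Rabs_Ropp; split; apply: B; [apply: COS_bound|apply: SIN_bound].
Qed.

(** Both components fit [Rabs_unit_comb_le] with [k] in the role of [T], up to a rotation of the
    sine-cosine pair. *)
Lemma perron_kernel_bound (k L t : R) : 0 < k ->
  Rabs (perron_re k L t) <= exp (k * L) / k /\ Rabs (perron_im k L t) <= exp (k * L) / k.
Proof.
move=> k0; have p := sum_sqr_pos k t (Rgt_not_eq _ _ k0).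
have sc := sin2_cos2 (t * L); rewrite /Rsqr in sc.
have e0 := exp_pos (k * L).
have -> : perron_re k L t = exp (k * L) *
    ((t * sin (t * L) - k * - cos (t * L)) / (t * t + k * k)).
  by rewrite /perron_re; field; lra.
have -> : perron_im k L t = exp (k * L) *
    ((t * - cos (t * L) - k * - sin (t * L)) / (t * t + k * k)).
  by rewrite /perron_im; field; lra.
rewrite !(Rabs_mult (exp _)) Rabs_pos_eq; last lra.
by split; (apply: Rmult_le_compat_l; [lra|apply: Rabs_unit_comb_le; [|lra]]).
Qed.

Lemma is_RInt_sum_n (f : nat -> R -> R) (v : nat -> R) (a b : R) (N : nat) :
  (forall i, is_RInt (f i) a b (v i)) ->
  is_RInt (fun t => sum_n (fun i => f i t) N) a b (sum_n v N).
Proof.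
move=> h; elim: N => [|N IH].
  by rewrite sum_O; apply: is_RInt_ext (h 0%N) => t _; rewrite sum_O.
rewrite sum_Sn; apply: is_RInt_ext (is_RInt_plus _ _ _ _ _ _ IH (h N.+1)) => t _.
by rewrite sum_Sn.
Qed.

(** The integrand is odd in [t], so the integral equals its own negative. *)
Lemma is_RInt_perron_im (k L T : R) : 0 < k -> is_RInt (perron_im k L) (- T) T 0.
Proof.
move=> k0.
have E : ex_RInt (perron_im k L) (- T) T.
  by apply: ex_RInt_continuous => t _; apply: continuous_perron_im; lra.
have I := RInt_correct _ _ _ E.
have I' : is_RInt (perron_im k L) (- - T) (- T) (- RInt (perron_im k L) (- T) T).
  by rewrite Ropp_involutive; apply: is_RInt_swap.
have J := is_RInt_comp_opp _ _ _ _ I'.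
have J' : is_RInt (perron_im k L) (- T) T (- RInt (perron_im k L) (- T) T).
  apply: is_RInt_ext J => t _; rewrite /opp /= /perron_im.
  rewrite Ropp_mult_distr_l_reverse cos_neg sin_neg.
  have p := sum_sqr_pos k t (Rgt_not_eq _ _ k0); field; lra.
have e := is_RInt_unique _ _ _ _ J'.
have e0 : RInt (perron_im k L) (- T) T = 0 by lra.
by rewrite e0 in I.
Qed.

Lemma sum_n_Rabs_le (f : nat -> R) (N : nat) :
  Rabs (sum_n f N) <= sum_n (fun i => Rabs (f i)) N.
Proof.
elim: N => [|N IH]; first by rewrite !sum_O; lra.
rewrite !sum_Sn /plus /=; have := Rabs_triang (sum_n f N) (f N.+1); lra.
Qed.

Definition perron_integral (x k T : R) (n : nat) : R :=
  RInt (perron_re k (ln x - ln (INR n))) (- T) T.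

(** The bound [e] is free of [t]. Each component of the complex product is a sum of two real
    products, each at most [e], whence the factor 2. *)
Lemma perron_partial_sum_error (x k t : R) (N : nat) : 1 < k ->
  let e := exp (k * ln x) / k *
    (Series (fun i => inv_pow k i.+1) - sum_n (fun i => inv_pow k i.+1) N) in
  let g := (Rcpow x (k, t) / (k, t) * log_zeta (k, t))%C in
  Rabs (sum_n (fun i => log_zeta_coef i.+1 * perron_re k (ln x - ln (INR i.+1)) t) N
        - Re g) <= 2 * e /\
  Rabs (sum_n (fun i => log_zeta_coef i.+1 * perron_im k (ln x - ln (INR i.+1)) t) N
        - Im g) <= 2 * e.
Proof.
move=> k1; have k0 : 0 < k by lra.
set W := exp (k * ln x) / k; set tau := Series _ - _; move=> e g.
have := perron_partial_sum x k t N k0.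
set U := sum_n _ N; set V := sum_n _ N; set A := sum_n _ N; set B := sum_n _ N.
have es := ex_series_inv_pow k k1.
have dU : Rabs (Series (fun i => Re (log_zeta_term (k, t) i.+1)) - U) <= tau.
  by apply: Series_sub_sum_n_le => // i; case: (log_zeta_term_bound k t i.+1).
have dV : Rabs (Series (fun i => Im (log_zeta_term (k, t) i.+1)) - V) <= tau.
  by apply: Series_sub_sum_n_le => // i; case: (log_zeta_term_bound k t i.+1).
move: dU dV; rewrite /g /log_zeta Rcpow_div_pair //.
set Z := Series _; set Y := Series _ => dU dV.
have [wr wi] := perron_kernel_bound k (ln x) t k0.
move: (perron_re _ _ _) (perron_im _ _ _) wr wi => a b wr wi.
rewrite -/W in wr wi; rewrite /Cmult /= => -[<- <-].
have P p q d f : Rabs p <= W -> Rabs q <= W -> Rabs d <= tau -> Rabs f <= tau ->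
    Rabs (p * d + q * f) <= 2 * e.
  move=> hp hq hd hf; apply: Rle_trans (Rabs_triang _ _) _; rewrite !Rabs_mult /e.
  have := Rmult_le_compat _ _ _ _ (Rabs_pos p) (Rabs_pos d) hp hd.
  have := Rmult_le_compat _ _ _ _ (Rabs_pos q) (Rabs_pos f) hq hf; lra.
split.
- have -> : a * U - b * V - (a * Z - b * Y) = (- a) * (Z - U) + b * (Y - V) by ring.
  by apply: P; rewrite ?Rabs_Ropp.
- have -> : a * V + b * U - (a * Y + b * Z) = (- a) * (Y - V) + (- b) * (Z - U) by ring.
  by apply: P; rewrite ?Rabs_Ropp.
Qed.

(** Uniform convergence on the segment allows termwise integration; each imaginary part integrates
    to 0, so the limit is real. *)
Lemma perron_integral_series (x k T : R) : 1 < k -> exists I : R,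
  is_RInt (V := C_R_CompleteNormedModule)
    (fun t => (Rcpow x (k, t) / (k, t) * log_zeta (k, t))%C) (- T) T (I, 0) /\
  is_lim_seq (sum_n (fun i => log_zeta_coef i.+1 * perron_integral x k T i.+1)) I.
Proof.
move=> k1; have k0 : 0 < k by lra.
pose F (N : nat) (t : R) : C :=
  (sum_n (fun i => log_zeta_coef i.+1 * perron_re k (ln x - ln (INR i.+1)) t) N,
   sum_n (fun i => log_zeta_coef i.+1 * perron_im k (ln x - ln (INR i.+1)) t) N).
pose S := sum_n (fun i => log_zeta_coef i.+1 * perron_integral x k T i.+1).
have HF N : is_RInt (V := C_R_CompleteNormedModule) (F N) (- T) T (S N, 0).
  apply: (is_RInt_fct_extend_pair (U := R_NormedModule) (V := R_NormedModule)).
    apply: is_RInt_sum_n => i; apply: (is_RInt_scal (V := R_NormedModule)).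
    apply: RInt_correct; apply: ex_RInt_continuous => t _; apply: continuous_perron_re; lra.
  have -> : 0 = sum_n (fun i => log_zeta_coef i.+1 * 0) N.
    rewrite (sum_n_ext _ (fun=> 0)) => [|i]; last exact: Rmult_0_r.
    by rewrite sum_n_const Rmult_0_r.
  apply: is_RInt_sum_n => i; apply: (is_RInt_scal (V := R_NormedModule)).
  exact: is_RInt_perron_im.
(* Convergence in the function space is uniform in [t], as [filterlim_RInt] requires. *)
have lim : filterlim F eventually (locally ((fun t =>
    (Rcpow x (k, t) / (k, t) * log_zeta (k, t))%C) : fct_UniformSpace R C_R_CompleteNormedModule)).
  apply/filterlim_locally => eps.
  pose W := exp (k * ln x) / k.
  have W0 : 0 < W by apply: Rdiv_lt_0_compat => //; apply: exp_pos.
  have es := ex_series_inv_pow k k1.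
  have d0 : 0 < eps / (2 * W) by apply: Rdiv_lt_0_compat; [exact: cond_pos|lra].
  have /filterlim_locally/(_ (mkposreal _ d0)) := Series_correct _ es.
  apply: filter_imp => N hN t.
  have {}hN : Rabs (sum_n (fun i => inv_pow k i.+1) N - Series (fun i => inv_pow k i.+1))
    < eps / (2 * W) by exact: hN.
  have [h1 h2] := perron_partial_sum_error x k t N k1.
  have h3 : 2 * (exp (k * ln x) / k * (Series (fun i => inv_pow k i.+1)
      - sum_n (fun i => inv_pow k i.+1) N)) < eps.
    rewrite -/W; have -> : pos eps = 2 * (W * (eps / (2 * W))) by field; lra.
    apply: Rmult_lt_compat_l; first lra.
    apply: Rmult_lt_compat_l => //; apply: Rle_lt_trans hN.
    rewrite Rabs_minus_sym; exact: Rle_abs.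
  by split; [apply: Rle_lt_trans h1 h3|apply: Rle_lt_trans h2 h3].
have [[I J] [hI hInt]] :=
  filterlim_RInt (V := C_R_CompleteNormedModule) F (- T) T eventually _ _ (fun N => (S N, 0)) HF lim.
move/filterlim_locally: hI => hI.
have J0 : J = 0.
  apply: cond_eq => eps eps0; have [N hN] := hI (mkposreal _ eps0).
  have [_ h] := hN N (le_n N); rewrite Rabs_minus_sym; exact: h.
exists I; rewrite -{1}J0; split => //.
apply/is_lim_seq_spec => eps; have [N hN] := hI eps; exists N => n /hN[h _]; exact: h.
Qed.

(** * Assembly of the estimate *)

(** Termwise [perron_bound] with [0 <= a_n <= 1]: exactly the [n <= m] have [0 < L] and contribute
    [2 PI a_n]. The constant is 2 times the 21 of [sum_perron_weight_le]. *)
Lemma perron_sum_bound (m N : nat) (T : R) : (1 < m)%N -> 0 < T -> (m <= N.+1)%N ->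
  let x := INR m + / 2 in
  Rabs (sum_n (fun i => log_zeta_coef i.+1 * perron_integral x (1 + / ln x) T i.+1) N
        - 2 * PI * sum_n (fun i => log_zeta_coef i.+1) m.-1)
  <= 42 * exp 1 * (x * ln x / T).
Proof.
move=> m1 T0 mN x; have m2 : 2 <= INR m by have /leP/le_INR := m1.
have x2 : 2 < x by rewrite /x; lra.
have lx := ln_half_le x x2; have lx0 : 0 < / ln x by apply: Rinv_0_lt_compat; lra.
set k := 1 + / ln x.
rewrite -(sum_n_truncate _ _ _ (ltnW m1) mN) -sum_n_Rmult_l -sum_n_Rminus.
apply: Rle_trans (sum_n_Rabs_le _ _) _.
have -> : 42 * exp 1 * (x * ln x / T) = 2 / T * (21 * exp 1 * (x * ln x)) by field; lra.
apply: (Rle_trans _ (sum_n (fun i => 2 / T * perron_weight k x i.+1) N)); last first.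
  rewrite sum_n_Rmult_l; apply: Rmult_le_compat_l; last exact: sum_perron_weight_le.
  by left; apply: Rdiv_lt_0_compat; lra.
apply: sum_n_Rle => i _.
set L := ln x - ln (INR i.+1); have i1 := INR_ge1 i.
have LE : L <> 0 /\ (if Rlt_dec 0 L then 2 * PI else 0) = if (i < m)%N then 2 * PI else 0.
  case: (ltnP i m) => im.
    have /leP/le_INR h := im.
    have : ln (INR i.+1) < ln x by apply: ln_increasing; rewrite /x; lra.
    move=> lt; split; first by rewrite /L; lra.
    by case: Rlt_dec => // h1; case: h1; rewrite /L; lra.
  have /leP/le_INR h : (m.+1 <= i.+1)%N := im.
  rewrite S_INR in h.
  have : ln x < ln (INR i.+1) by apply: ln_increasing; rewrite /x; lra.
  move=> lt; split; first by rewrite /L; lra.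
  by case: Rlt_dec => // h1; have h2 : 0 < ln x - ln (INR i.+1) := h1; lra.
have [L0 ifE] := LE.
have B := perron_bound k T L ltac:(rewrite /k; lra) T0 L0.
rewrite ifE in B.
have [a0 a1] := log_zeta_coef_bounds i.+1.
have -> : log_zeta_coef i.+1 * perron_integral x k T i.+1 -
    2 * PI * (if (i < m)%N then log_zeta_coef i.+1 else 0) =
  log_zeta_coef i.+1 * (RInt (perron_re k L) (- T) T - (if (i < m)%N then 2 * PI else 0)).
  by rewrite /perron_integral -/L; case: ifP => _; ring.
rewrite Rabs_mult Rabs_pos_eq //.
have -> : 2 / T * perron_weight k x i.+1 = 2 * exp (k * L) / (T * Rabs L).
  by rewrite /perron_weight -/L; field; split; [apply: Rabs_no_R0|lra].
apply: Rle_trans B; rewrite -[X in _ <= X]Rmult_1_l.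
by apply: Rmult_le_compat_r; [apply: Rabs_pos|].
Qed.

(** The [i] of [ds = i dt] cancels that of [2 PI i], so a real integral makes [R2] real. *)
Lemma Cmod_R2 (x T I : R) : let k := 1 + 1 / ln x in
  is_RInt (V := C_R_CompleteNormedModule)
    (fun t => (Rcpow x (k, t) / (k, t) * log_zeta (k, t))%C) (- T) T (I, 0) ->
  Cmod (R2 x T) = Rabs (INR (prime_pi x) - I / (2 * PI)).
Proof.
move=> k h; have p := PI_RGT_0.
rewrite -Cmod_R /R2 /vertical_integral -/k (is_RInt_unique _ _ _ _ h); congr Cmod.
by rewrite /RtoC /Ci /Cminus /Cplus /Copp /Cmult /Cinv /=; congr pair; field; lra.
Qed.

Theorem theorem2 :
  exists K : R, 0 < K /\
    forall x T : R, half_odd x -> 2 < x -> 0 < T ->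
      Cmod (R2 x T) <= K * (x * ln x / T + sqrt x * Rabs (ln (ln x))).
Proof.
have [c c0 hc] := ln_ln_half_odd_bounded_below.
have l6 : 0 < ln 6 by rewrite -ln_1; apply: ln_increasing; lra.
have e0 := exp_pos 1; have cl : 0 < c * ln 6 by apply: Rmult_lt_0_compat.
(* [42 e] comes from the Perron errors, using [1 / (2 PI) <= 1]; the rest comes from the prime
   powers, with [ln 6] absorbed by [1 <= c |ln (ln x)|]. *)
exists (42 * exp 1 + 2 * (c * ln 6 + 1)); split => [|x T /half_odd_nat h x2 T0]; first lra.
have [m m1 xE] := h x2; have lx := ln_half_le x x2.
have lx0 : 0 < / ln x by apply: Rinv_0_lt_compat; lra.
have [I [hI limI]] := perron_integral_series x (1 + 1 / ln x) T ltac:(lra).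
rewrite (Cmod_R2 _ _ _ hI).
have kE : 1 + 1 / ln x = 1 + / ln x by rewrite /Rdiv Rmult_1_l.
rewrite kE in limI.
set P := sum_n (fun i => log_zeta_coef i.+1) m.-1.
have hP := prime_power_sum_sub_prime_pi m m1; rewrite /= -xE -/P in hP.
have hS : Rabs (I - 2 * PI * P) <= 42 * exp 1 * (x * ln x / T).
  apply: le_epsilon => eps eps0.
  move/is_lim_seq_spec: limI => /(_ (mkposreal _ eps0)) [N hN].
  (* An index past [N], where the partial sum is within [eps] of [I], and past [m], where the finite
     bound applies. *)
  have := hN (maxn m N) ltac:(apply/leP; exact: leq_maxr).
  set S := sum_n _ _ => /= hS1.
  have := perron_sum_bound m (maxn m N) T m1 T0 (leqW (leq_maxl _ _)).
  rewrite /= -xE -/P -/S => hS2.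
  have -> : I - 2 * PI * P = - (S - I) + (S - 2 * PI * P) by ring.
  apply: Rle_trans (Rabs_triang _ _) _; rewrite Rabs_Ropp; lra.
have hl := hc m m1; rewrite -xE in hl.
set l := Rabs (ln (ln x)) in hl *; set s := sqrt x in hP *.
have s0 : 0 <= s by apply: sqrt_pos.
have l0 : 0 <= l by apply: Rabs_pos.
have p3 := PI2_3_2; have p0 := PI_RGT_0.
have -> : INR (prime_pi x) - I / (2 * PI)
   = - (P - INR (prime_pi x)) + - ((I - 2 * PI * P) * / (2 * PI)) by field; lra.
apply: Rle_trans (Rabs_triang _ _) _; rewrite !Rabs_Ropp Rabs_mult.
rewrite (Rabs_pos_eq (P - _)); last by case: hP.
have i1 : 0 < / (2 * PI) by apply: Rinv_0_lt_compat; lra.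
have i2 : / (2 * PI) <= 1 by rewrite -Rinv_1; apply: Rinv_le_contravar; lra.
rewrite (Rabs_pos_eq (/ _)); last lra.
have h1 := Rmult_le_compat _ _ _ _ (Rabs_pos _) (Rlt_le _ _ i1) hS i2.
have h2 : ln 6 + ln (ln x) <= (c * ln 6 + 1) * l.
  have := Rmult_le_compat_l _ _ _ (Rlt_le _ _ l6) hl; have := Rle_abs (ln (ln x)).
  rewrite -/l; lra.
have h3 := Rmult_le_compat_l (2 * s) _ _ ltac:(lra) h2.
have q0 : 0 <= x * ln x / T by left; apply: Rdiv_lt_0_compat => //; apply: Rmult_lt_0_compat; lra.
have h4 := Rmult_le_pos _ _ s0 l0.
have h5 := Rmult_le_pos _ _ (Rlt_le _ _ e0) h4.
have h6 := Rmult_le_pos _ _ (Rlt_le _ _ cl) q0.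
lra.
Qed.
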